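(* Let $X$ carry a torsion-free Grassmannian structure of type $(2n,2)$, $n\ge1$, with invariant curvature $\Psi_{ABC}{}^{D}$. If there exists a compatible metric, then for every $k\in\mathbb N$, $k\ge 1$, we have $$\Psi_{A_1B_1C_1}{}^{C_2}\Psi_{A_2B_2C_2}{}^{C_3}\cdots\Psi_{A_kB_kC_k}{}^{C_1}+(-1)^{k+1}\,\Psi_{A_kB_kC_1}{}^{C_2}\Psi_{A_{k-1}B_{k-1}C_2}{}^{C_3}\cdots\Psi_{A_1B_1C_k}{}^{C_1}=0 .$$
   Context: Everything is holomorphic; one works over a contractible complex manifold $X$ of dimension $4n$. A $(2n,2)$-almost-Grassmannian structure is an isomorphism $TX\cong S\otimes S'$ with $S,S'$ vector bundles of ranks $2n$ and $2$. Penrose abstract indices are used: unprimed/primed upper indices label $S$/$S'$, lower indices the duals, repeated indices are contracted; round/square brackets denote (skew-)symmetrisation. $\mathcal O[k]:=(\wedge^2S')^k$, $E[k]:=E\otimes\mathcal O[k]$; $\epsilon^{A'B'}\in\Gamma(\wedge^2S'[-1])$, $\epsilon_{A'B'}\in\Gamma(\wedge^2S'^*[1])$ are the canonical sections, used to lower and raise primed indices by $o_{B'}=o^{A'}\epsilon_{A'B'}$, $o^{A'}=\epsilon^{A'B'}o_{B'}$. Weyl connections: given nowhere-vanishing sections (scales) $\omega_{AB\ldots C}\in\Gamma(\wedge^{2n}S^* )$, $\eta_{A'B'}\in\Gamma(\wedge^2S'^* )$ there is a unique pair of connections on $S$ and $S'$, both written $\nabla_{AA'}$, for which these sections are parallel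 and for which the induced connection on $TX$ has totally trace-free torsion; that torsion does not depend on the scales. An $\alpha$-plane at $x$ is a subspace $\{p\otimes q: p\in S_x\}$ with $0\ne q\in S'_x$ fixed; the structure is right-flat if every $\alpha$-plane is tangent to a $2n$-dimensional submanifold all of whose tangent planes are $\alpha$-planes. A torsion-free Grassmannian structure (TFG) is an almost-Grassmannian structure that is right-flat and whose invariant torsion vanishes. On a TFG the curvature of Weyl connections is $$\nabla_{(A|A'}\nabla_{|B)}{}^{A'}\mu^D=(\Psi_{ABC}{}^D-2\Lambda_{C(A}\delta_{B)}{}^D)\mu^C,\quad \nabla_{(A|A'}\nabla_{|B)}{}^{A'}\nu^{B'}=\Phi_{ABA'}{}^{B'}\nu^{A'},$$ $$\nabla_{[A}{}^{(A'}\nabla_{B]}{}^{B')}\mu^D=\delta_{[A}{}^D\Phi_{B]C}{}^{A'B'}\mu^C,\quad \nabla_{[A}{}^{(A'}\nabla_{B]}{}^{B')}\mu^{C'}=\Lambda_{AB}\epsilon^{C'(A'}\mu^{B')},$$ with $\Phi_{ABA'B'}=\Phi_{(AB)(A'B')}$, $\Lambda_{AB}=\Lambda_{[AB]}\in\Gamma(\wedge^2S^*[-1])$ and $\Psi_{ABC}{}^D=\Psi_{(ABC)}{}^D\in\Gamma((\odot^3S^*\otimes S)_\circ[-1])$ trace-free; $\Psi_{ABC}{}^D$ is independent of the Weyl connections and is called the invariant curvature. A holomorphic metric $g$ is compatible if $g_{AA'BB'}=\eta_{AB}\eta_{A'B'}$ for some non-degenerate $\eta_{AB}\in\Gamma(\wedge^2S^*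 )$, $\eta_{A'B'}\in\Gamma(\wedge^2S'^* )$ and there exist Weyl connections inducing the Levi-Civita connection of $g$ on $TX$. *)

(* Defs.v *)
From HB Require Import structures.
From mathcomp Require Import all_boot all_order all_algebra.
From mathcomp Require Import complex.
From mathcomp Require Import all_classical all_reals all_analysis.

Set Implicit Arguments.
Unset Strict Implicit.
Unset Printing Implicit Defensive.
Import Order.TTheory GRing.Theory Num.Theory numFieldNormedType.Exports.
Local Open Scope classical_set_scope.
Local Open Scope ring_scope.

(* Conventions.
   - The complex numbers are R[i] for an arbitrary R : realType; a function on
     an open subset of C^m is holomorphic when it is (Frechet) differentiable
     over R[i] at each point.  Scalar functions have codomain (cplx R)^o, the
     complex line seen as a normed module over itself.
   - A bundle over X is given by its transition functions relative to the atlas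
     of X.  Every finite family of holomorphic bundles is trivialised by a
     common refinement of the atlas, so nothing is lost by quantifying over all
     atlases.  Sections and connections are given by their components in the
     charts and trivialisations; component functions are total on X, but their
     values matter only on the domain of the chart (and on the open set where
     the section lives).
   - Component indices are tuples: an index of S is A : 'I_(2 * n), an index of
     S' is A' : 'I_2, an index of TX = S (x) S' is a pair (A, A'). *)

(* Typed as a numFieldType so that the normed topology of R[i] is inferred. *)
Definition cplx (R : realType) : numFieldType := R[i].

Section Manifold.
Variable R : realType.
Local Notation C := (cplx R).

Record manifold (m : nat) := Manifold {
  point :> topologicalType;
  idx : Type;
  dom : idx -> set point;
  chart : idx -> point -> 'rV[C]_m;
  chart_inv : idx -> 'rV[C]_m -> point;
  manifold_hausdorff : hausdorff_space point;
  manifold_countable : @second_countable point;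
  dom_open : forall i, open (dom i);
  dom_cover : forall x, exists i, dom i x;
  chart_open : forall i, open (chart i @` dom i);
  chartK : forall i x, dom i x -> chart_inv i (chart i x) = x;
  chart_continuous : forall i x, dom i x -> {for x, continuous (chart i)};
  chart_inv_continuous : forall i x, dom i x ->
    {for chart i x, continuous (chart_inv i)};
  chart_holomorphic : forall i j x, dom i x -> dom j x ->
    differentiable (chart j \o chart_inv i) (chart i x) }.

Definition contractible (X : topologicalType) : Prop :=
  exists (x0 : X) (H : R * X -> X),
    [/\ {within [set p | 0 <= p.1 <= 1], continuous H},
        forall x, H (0, x) = x &
        forall x, H (1, x) = x0].

Section Bundles.
Variables (m : nat) (X : manifold m).

Definition holomorphic_on (U : set X) (f : X -> C) : Prop :=
  forall i x, U x -> dom i x ->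
    differentiable ((f : X -> C^o) \o chart_inv i) (chart i x).

(* [g i j x f h] are the entries of the matrix relating the components of a
   section in the trivialisations i and j: s_i = g_ij s_j. *)
Definition cocycle (F : finType) := idx X -> idx X -> X -> F -> F -> C.

Definition is_bundle (F : finType) (g : cocycle F) : Prop :=
  [/\ forall i j f h, holomorphic_on (dom i `&` dom j) (fun x => g i j x f h),
      forall i x f h, dom i x -> g i i x f h = (f == h)%:R &
      forall i j k x f h, dom i x -> dom j x -> dom k x ->
        \sum_l g i j x f l * g j k x l h = g i k x f h].

Definition dual (F : finType) (g : cocycle F) : cocycle F :=
  fun i j x f h => g j i x h f.

Definition tens (F F' : finType) (g : cocycle F) (g' : cocycle F') :
    cocycle (F * F')%type :=
  fun i j x f h => g i j x f.1 h.1 * g' i j x f.2 h.2.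

(* The top exterior power; the component of a section is its coefficient on
   the wedge product of the local frame. *)
Definition detb (r : nat) (g : cocycle 'I_r) : cocycle unit :=
  fun i j x _ _ => \det (\matrix_(a < r, b < r) g i j x a b).

Definition components (F : finType) := idx X -> X -> F -> C.

Definition is_section (F : finType) (g : cocycle F) (U : set X)
    (s : components F) : Prop :=
  (forall i f, holomorphic_on (U `&` dom i) (fun x => s i x f)) /\
  (forall i j x f, U x -> dom i x -> dom j x ->
     s i x f = \sum_h g i j x f h * s j x h).

End Bundles.
End Manifold.

Section Grassmannian.
Variables (R : realType) (n : nat).
Local Notation C := (cplx R).
Local Notation I := ('I_(2 * n)).
Local Notation TI := ('I_(2 * n) * 'I_2)%type.

(* [frame i x (A, A')] is the tangent vector corresponding to s_A (x) s'_A',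
   in the coordinates of the chart i; [coframe i x (A, A')] is the dual basis,
   i.e. the isomorphism TX -> S (x) S' read in components. *)
Record ag_structure (X : manifold R (4 * n)) := AgStructure {
  spin : cocycle X I;
  spin' : cocycle X 'I_2;
  spin_bundle : is_bundle spin;
  spin'_bundle : is_bundle spin';
  frame : idx X -> X -> TI -> 'rV[C]_(4 * n);
  coframe : idx X -> X -> TI -> 'cV[C]_(4 * n);
  frame_holomorphic : forall i a c,
    holomorphic_on (dom i) (fun x => frame i x a 0 c);
  frameK : forall i x a b, dom i x ->
    (frame i x a *m coframe i x b) 0 0 = (a == b)%:R;
  coframeK : forall i x (v : 'rV[C]_(4 * n)), dom i x ->
    v = \sum_a (v *m coframe i x a) 0 0 *: frame i x a;
  frame_compat : forall i j x a, dom i x -> dom j x ->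
    'd (chart j \o chart_inv i) (chart i x) (frame i x a) =
    \sum_b tens spin spin' j i x b a *: frame j x b }.

Variables (X : manifold R (4 * n)) (G : ag_structure X).

Local Notation S := (spin G).
Local Notation S' := (spin' G).
Local Notation TX := (tens S S').
Local Notation Om1 := (dual (detb S')).  (* O[-1] *)

Definition dframe (i : idx X) (a : TI) (f : X -> C) (x : X) : C :=
  'D_(frame G i x a) ((f : X -> C^o) \o chart_inv i) (chart i x).

(* Connection coefficients: in the trivialisation i,
   (nabla_a s)^f = e_a (s^f) + \sum_h Gam i x a f h * s^h,
   where e_a = frame G i x a. *)
Definition coeffs (F : finType) := idx X -> X -> TI -> F -> F -> C.

Definition is_connection (F : finType) (g : cocycle X F) (U : set X)
    (Gam : coeffs F) : Prop :=
  (forall i a f h, holomorphic_on (U `&` dom i) (fun x => Gam i x a f h)) /\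
  (forall i j x a f h, U x -> dom i x -> dom j x ->
     dframe i a (fun y => g i j y f h) x + \sum_l Gam i x a f l * g i j x l h =
     \sum_l g i j x f l * \sum_b TX j i x b a * Gam j x b l h).

Definition dual_conn (F : finType) (Gam : coeffs F) : coeffs F :=
  fun i x a f h => - Gam i x a h f.

Definition tens_conn (F F' : finType) (Gam : coeffs F) (Gam' : coeffs F') :
    coeffs (F * F')%type :=
  fun i x a f h => Gam i x a f.1 h.1 * (f.2 == h.2)%:R +
                   (f.1 == h.1)%:R * Gam' i x a f.2 h.2.

Definition det_conn (F : finType) (Gam : coeffs F) : coeffs unit :=
  fun i x a _ _ => \sum_f Gam i x a f f.

Definition nabla (F : finType) (Gam : coeffs F) (i : idx X) (s : X -> F -> C) :
    X -> TI * F -> C :=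
  fun x af => dframe i af.1 (fun y => s y af.2) x +
              \sum_h Gam i x af.1 af.2 h * s x h.

(* [nabla2 Gam Gam' GamE i s x (a, (b, f))] is nabla_a nabla_b s^f. *)
Definition nabla2 (Gam : coeffs I) (Gam' : coeffs 'I_2) (F : finType)
    (GamE : coeffs F) (i : idx X) (s : X -> F -> C) : X -> TI * (TI * F) -> C :=
  nabla (tens_conn (dual_conn (tens_conn Gam Gam')) GamE) i (nabla GamE i s).

Definition is_parallel (F : finType) (Gam : coeffs F) (U : set X)
    (s : components X F) : Prop :=
  forall i x a, U x -> dom i x -> nabla Gam i (s i) x a = 0.

Definition lie_bracket (i : idx X) (x : X) (a b : TI) : 'rV[C]_(4 * n) :=
  'D_(frame G i x a) ((fun y => frame G i y b) \o chart_inv i) (chart i x) -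
  'D_(frame G i x b) ((fun y => frame G i y a) \o chart_inv i) (chart i x).

(* T_(a b)^c for a connection on TX, from
   T(u, v) = nabla_u v - nabla_v u - [u, v] *)
Definition torsion (D : coeffs TI) (i : idx X) (x : X) (a b c : TI) : C :=
  D i x a c b - D i x b c a - (lie_bracket i x a b *m coframe G i x c) 0 0.

(* T_(a b)^c is skew in a b, so only contractions with a are needed. *)
Definition totally_trace_free (T : TI -> TI -> TI -> C) : Prop :=
  (forall A' b C', \sum_(A < 2 * n) T (A, A') b (A, C') = 0) /\
  (forall A b (D : I), \sum_(A' < 2) T (A, A') b (D, A') = 0).

Definition is_scale (r : nat) (g : cocycle X 'I_r) (U : set X)
    (w : components X unit) : Prop :=
  is_section (dual (detb g)) U w /\
  (forall i x, U x -> dom i x -> w i x tt != 0).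

Definition weyl_connections (U : set X) (Gam : coeffs I) (Gam' : coeffs 'I_2) :
    Prop :=
  [/\ is_connection S U Gam,
      is_connection S' U Gam',
      exists2 omega, is_scale S U omega &
        is_parallel (dual_conn (det_conn Gam)) U omega,
      exists2 eta, is_scale S' U eta &
        is_parallel (dual_conn (det_conn Gam')) U eta &
      forall i x, U x -> dom i x ->
        totally_trace_free (torsion (tens_conn Gam Gam') i x)].

Definition torsion_free (U : set X) (D : coeffs TI) : Prop :=
  forall i x a b c, U x -> dom i x -> torsion D i x a b c = 0.

Definition alpha_plane (i : idx X) (x : X) (q : 'I_2 -> C) :
    set 'rV[C]_(4 * n) :=
  [set v | exists p : I -> C,
     v = \sum_(a : TI) (p a.1 * q a.2) *: frame G i x a].

(* The submanifold is given near x by an injective holomorphic parametrisation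
   of dimension 2n; it is an immersion because alpha-planes have dimension 2n. *)
Definition right_flat : Prop :=
  forall (i : idx X) (x : X) (q : 'I_2 -> C), dom i x -> (exists A', q A' != 0) ->
  exists (V : set 'rV[C]_(2 * n)) (f : 'rV[C]_(2 * n) -> 'rV[C]_(4 * n)),
    [/\ open V /\ V 0,
        f 0 = chart i x,
        forall s t, V s -> V t -> f s = f t -> s = t,
        range ('d f 0) = alpha_plane i x q &
        forall t, V t -> exists y,
          [/\ dom i y, chart i y = f t, differentiable f t &
              exists2 r : 'I_2 -> C, (exists A', r A' != 0) &
                range ('d f t) = alpha_plane i y r]].

(* The torsion of Weyl connections does not depend on the scales; scales exist
   locally, hence the quantification over open subsets. *)
Definition tfg : Prop :=
  right_flat /\
  (forall U Gam Gam', open U -> weyl_connections U Gam Gam' ->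
     torsion_free U (tens_conn Gam Gam')).

(* The canonical skew forms: epsilon^(A'B') is a section of S' (x) S' (x) O[-1]
   and epsilon_(A'B') of S'* (x) S'* (x) O[1]; in the trivialisation of O[k]
   induced by that of S', both have these constant components. *)
Definition eps (A' B' : 'I_2) : C := (A' < B')%N%:R - (B' < A')%N%:R.

Definition sym2 (T : Type) (f : T -> T -> C) (a b : T) : C :=
  2^-1 * (f a b + f b a).

Definition skew2 (T : Type) (f : T -> T -> C) (a b : T) : C :=
  2^-1 * (f a b - f b a).

Section Curvature.
Variables (Gam : coeffs I) (Gam' : coeffs 'I_2).
Variables (F : finType) (GamE : coeffs F).
Variables (i : idx X) (s : X -> F -> C) (x : X).

(* nabla_((A|A') nabla_(|B))^(A') s^f, with nabla_B^(A') = eps^(A'B') nabla_(BB').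
   Since epsilon is parallel, indices may be raised after differentiation. *)
Definition box (A B : I) (f : F) : C :=
  sym2 (fun A B => \sum_(A' < 2) \sum_(B' < 2)
    eps A' B' * nabla2 Gam Gam' GamE i s x ((A, A'), ((B, B'), f))) A B.

(* nabla_[A^(A') nabla_B]^(B') s^f, symmetrised over A' B' *)
Definition box' (A B : I) (A' B' : 'I_2) (f : F) : C :=
  skew2 (fun A B => sym2 (fun A' B' => \sum_(C' < 2) \sum_(D' < 2)
    eps A' C' * eps B' D' *
    nabla2 Gam Gam' GamE i s x ((A, C'), ((B, D'), f))) A' B') A B.

End Curvature.

Local Notation PsiI := (I * I * I * I * unit)%type.
Local Notation PhiI := (I * I * 'I_2 * 'I_2)%type.
Local Notation LamI := (I * I * unit)%type.

(* Psi, Phi and Lambda are the components, at a point x of the domain of the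
   chart i, of Psi_(ABC)^D, Phi_(ABA'B') and Lambda_(AB); mu and nu are local
   sections of S and S'. *)
Definition curvature_equations (Gam : coeffs I) (Gam' : coeffs 'I_2)
    (i : idx X) (x : X)
    (Psi : PsiI -> C) (Phi : PhiI -> C) (Lam : LamI -> C)
    (mu : X -> I -> C) (nu : X -> 'I_2 -> C) : Prop :=
  let Phi1 A B A' B' := \sum_C' eps B' C' * Phi (A, B, A', C') in
  let Phi2 A B A' B' :=
    \sum_C' \sum_D' eps A' C' * eps B' D' * Phi (A, B, C', D') in
  let delta (A D : I) : C := (A == D)%:R in
  [/\ forall A B D, box Gam Gam' Gam i mu x A B D =
        \sum_(E < 2 * n) (Psi (A, B, E, D, tt) -
          2 * sym2 (fun A B => Lam (E, A, tt) * delta B D) A B) * mu x E,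
      forall A B B', box Gam Gam' Gam' i nu x A B B' =
        \sum_(A' < 2) Phi1 A B A' B' * nu x A',
      forall A B A' B' D, box' Gam Gam' Gam i mu x A B A' B' D =
        \sum_(E < 2 * n)
          skew2 (fun A B => delta A D * Phi2 B E A' B') A B * mu x E &
      forall A B A' B' C', box' Gam Gam' Gam' i nu x A B A' B' C' =
        Lam (A, B, tt) * sym2 (fun A' B' => eps C' A' * nu x B') A' B'].

Definition invariant_curvature (Psi : components X PsiI) : Prop :=
  [/\ is_section (tens (tens (tens (tens (dual S) (dual S)) (dual S)) S) Om1)
        setT Psi,
      forall i x A B E D, dom i x ->
        Psi i x (A, B, E, D, tt) = Psi i x (B, A, E, D, tt) /\
        Psi i x (A, B, E, D, tt) = Psi i x (A, E, B, D, tt),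
      forall i x A B, dom i x -> \sum_(E < 2 * n) Psi i x (A, B, E, E, tt) = 0 &
      forall U Gam Gam', open U -> weyl_connections U Gam Gam' ->
      exists (Phi : components X PhiI) (Lam : components X LamI),
      [/\ is_section (tens (tens (tens (dual S) (dual S)) (dual S')) (dual S'))
            U Phi /\
          is_section (tens (tens (dual S) (dual S)) Om1) U Lam,
          forall i x A B A' B', U x -> dom i x ->
            Phi i x (A, B, A', B') = Phi i x (B, A, A', B') /\
            Phi i x (A, B, A', B') = Phi i x (A, B, B', A'),
          forall i x A B, U x -> dom i x ->
            Lam i x (A, B, tt) = - Lam i x (B, A, tt) &
          forall i (V : set X) (mu : X -> I -> C) (nu : X -> 'I_2 -> C),
            open V -> V `<=` U `&` dom i ->
            (forall A, holomorphic_on V (fun y => mu y A)) ->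
            (forall A', holomorphic_on V (fun y => nu y A')) ->
            forall x, V x ->
            curvature_equations Gam Gam' i x (Psi i x) (Phi i x) (Lam i x)
              mu nu]].

Definition nondegenerate (F : finType) (b : F * F -> C) : Prop :=
  forall v : F -> C,
    (forall h, \sum_f v f * b (f, h) = 0) -> forall f, v f = 0.

Definition is_metric (g : components X (TI * TI)%type) : Prop :=
  [/\ is_section (tens (dual TX) (dual TX)) setT g,
      forall i x a b, dom i x -> g i x (a, b) = g i x (b, a) &
      forall i x, dom i x -> nondegenerate (g i x)].

Definition is_skew_form (F : finType) (c : cocycle X F)
    (eta : components X (F * F)%type) : Prop :=
  [/\ is_section (tens (dual c) (dual c)) setT eta,
      forall i x f h, dom i x -> eta i x (f, h) = - eta i x (h, f) &
      forall i x, dom i x -> nondegenerate (eta i x)].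

Definition levi_civita (g : components X (TI * TI)%type) (D : coeffs TI) : Prop :=
  [/\ is_connection TX setT D,
      torsion_free setT D &
      is_parallel (tens_conn (dual_conn D) (dual_conn D)) setT g].

Definition compatible_metric (g : components X (TI * TI)%type) : Prop :=
  [/\ is_metric g,
      exists eta eta', [/\ is_skew_form S eta, is_skew_form S' eta' &
        forall i x (a b : TI), dom i x ->
          g i x (a, b) = eta i x (a.1, b.1) * eta' i x (a.2, b.2)] &
      exists Gam Gam', weyl_connections setT Gam Gam' /\
        levi_civita g (tens_conn Gam Gam')].

End Grassmannian.

(* Main.v *)
(** The compatible metric g = eta (x) eta' is parallel, so the contracted
    commutator of covariant derivatives kills it.  On S' that commutator acts by
    the trace-free Phi and hence annihilates eta'; therefore the curvature
    Psi_ABC^D - 2 Lambda_C(A delta_B)^D of S annihilates eta.  Tracing this with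
    the inverse of eta gives Lambda proportional to eta, after which the Lambda
    terms cancel and Psi_ABC^E eta_ED is symmetric in C and D.  So each
    matrix P = Psi_AB satisfies P eta = - eta P^T, and
    tr (P_1 ... P_k) = (-1)^k tr (P_k ... P_1).

    Commuting second derivatives are not proved from holomorphy: the curvature
    equations, applied to the sections h e_B' and e_B' of S', already say that
    the contracted commutator vanishes on the function h. *)
Require Import Defs.
From mathcomp Require Import all_boot all_order all_algebra.
From mathcomp Require Import complex ring.
From mathcomp Require Import all_classical all_reals all_analysis.

Set Implicit Arguments.
Unset Strict Implicit.
Unset Printing Implicit Defensive.
Import Order.TTheory GRing.Theory Num.Theory numFieldNormedType.Exports.
Local Open Scope ring_scope.

(** * Traces of matrix products, written as cyclic sums over index assignments *)

Lemma ordS_rev_ordS k (l : 'I_k) : ordS (rev_ord (ordS l)) = rev_ord l.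
Proof.
apply/val_inj => /=.
have := ltn_ord l; rewrite leq_eqVlt => /predU1P[->|lk].
  by rewrite modnn subn1 prednK ?(leq_trans _ (ltn_ord l))// modnn subnn.
by rewrite (modn_small lk) subnSK// modn_small// ltn_subrL (leq_trans _ lk).
Qed.

Section CyclicSums.
Variables (R : comNzRingType) (m k : nat).
Implicit Types (P N : 'I_k -> 'M[R]_m) (Z : 'M[R]_m).

(** The left side is the trace of a product of transposes. Walking round the cycle backwards, with
    both the positions and the assignment [c] reversed, turns it into the trace of the product in
    reverse order; [ordS_rev_ordS] realigns the neighbours. *)
Lemma cyclic_sum_rev P :
  \sum_(c : {ffun 'I_k -> 'I_m}) \prod_(l < k) P (ordS l) (c (ordS l)) (c l) =
  \sum_(c : {ffun 'I_k -> 'I_m}) \prod_(l < k) P (rev_ord l) (c l) (c (ordS l)).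
Proof.
have revK :
    involutive (fun c : {ffun 'I_k -> 'I_m} => [ffun l => c (rev_ord l)]).
  by move=> c; apply/ffunP => l; rewrite !ffunE rev_ordK.
rewrite [RHS](reindex_inj (inv_inj revK)); apply: eq_bigr => c _.
rewrite [RHS](reindex_inj rev_ord_inj) [RHS](reindex_inj (can_inj (@ordSK k))).
by apply: eq_bigr => l _; rewrite !ffunE ordS_rev_ordS !rev_ordK.
Qed.

(** Cyclicity of the trace. Both sides sum over closed walks that alternate [N]-steps and [Z]-steps;
    the start-points of the [N]-steps are outer vertices on the left and intermediate ones on the
    right, so exchanging the two sums and shifting by one position identifies them. *)
Lemma cyclic_sum_mulC N Z :
  \sum_(c : {ffun 'I_k -> 'I_m}) \prod_(l < k) (N l *m Z) (c l) (c (ordS l)) =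
  \sum_(c : {ffun 'I_k -> 'I_m})
    \prod_(l < k) (Z *m N (ordS l)) (c l) (c (ordS l)).
Proof.
have expand (M M' : 'I_k -> 'M[R]_m) (c : {ffun 'I_k -> 'I_m}) :
    \prod_(l < k) (M l *m M' l) (c l) (c (ordS l)) =
    \sum_(d : {ffun 'I_k -> 'I_m})
      (\prod_(l < k) M l (c l) (d l)) * \prod_(l < k) M' l (d l) (c (ordS l)).
  under eq_bigr do rewrite mxE.
  by rewrite bigA_distr_bigA; apply: eq_bigr => d _; rewrite big_split.
under eq_bigr do rewrite expand.
under [RHS]eq_bigr do rewrite (expand (fun=> Z) (fun l => N (ordS l))).
rewrite exchange_big; apply: eq_bigr => d _.
have shiftK : cancel (fun c : {ffun 'I_k -> 'I_m} => [ffun l => c (ordS l)])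
                     (fun c => [ffun l => c (ord_pred l)]).
  by move=> c; apply/ffunP => l; rewrite !ffunE ord_predK.
rewrite [RHS](reindex_inj (can_inj shiftK)); apply: eq_bigr => c _.
rewrite mulrC [X in _ * X](reindex_inj (can_inj (@ordSK k))).
by congr (_ * _); apply: eq_bigr => l _; rewrite ffunE.
Qed.

End CyclicSums.

(** Write each factor as [(P l *m eta) *m invmx eta] and move every [invmx eta] onto the next
    factor. There [invmx eta *m (P l *m eta)] is minus the transpose of [P l]: the signs collect to
    [(-1) ^+ k], and the transposes reverse the order. *)
Lemma cyclic_sum_skew_adjoint (F : fieldType) m k (eta : 'M[F]_m)
    (P : 'I_k -> 'M[F]_m) :
  eta \in unitmx -> (forall l, P l *m eta = - (eta *m (P l)^T)) ->
  \sum_(c : {ffun 'I_k -> 'I_m}) \prod_(l < k) P l (c l) (c (ordS l)) =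
  (-1) ^+ k * \sum_(c : {ffun 'I_k -> 'I_m})
    \prod_(l < k) P (rev_ord l) (c l) (c (ordS l)).
Proof.
move=> eta_unit adj.
have PE l : P l = (P l *m eta) *m invmx eta by rewrite mulmxK.
have PtE l : invmx eta *m (P l *m eta) = - (P l)^T.
  by rewrite adj mulmxN mulKmx.
under eq_bigr do under eq_bigr do rewrite PE.
rewrite (cyclic_sum_mulC (fun l => P l *m eta)) -cyclic_sum_rev mulr_sumr.
apply: eq_bigr => c _; under eq_bigr do rewrite PtE !mxE -mulN1r.
by rewrite big_split prodr_const card_ord.
Qed.

(** * Algebra of a curvature on [S] that annihilates a symplectic form *)

Lemma sum_skew_sym (F : numFieldType) m (Z S : 'I_m -> 'I_m -> F) :
  (forall i j, Z i j = - Z j i) -> (forall i j, S i j = S j i) ->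
  \sum_i \sum_j Z i j * S i j = 0.
Proof.
move=> Zskew Ssym; apply/eqP; rewrite -eqNr -sumrN exchange_big; apply/eqP.
apply: eq_bigr => i _; rewrite -sumrN; apply: eq_bigr => j _.
by rewrite Zskew Ssym mulNr opprK.
Qed.

Section LoweredCurvature.
Variables (F : numFieldType) (m : nat) (eta : 'M[F]_m).
Variables (Psi : 'I_m -> 'I_m -> 'I_m -> 'I_m -> F) (Lam : 'I_m -> 'I_m -> F).
Hypothesis eta_unit : eta \in unitmx.
Hypothesis eta_skew : forall a b, eta a b = - eta b a.
Hypothesis Psi_sym12 : forall a b c d, Psi a b c d = Psi b a c d.
Hypothesis Psi_sym23 : forall a b c d, Psi a b c d = Psi a c b d.
Hypothesis Psi_trace : forall a b, \sum_c Psi a b c c = 0.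

(** The curvature of [S] with the symmetrisation expanded: [c] is the index contracted with the
    section, [d] the resulting upper index. *)
Local Notation curv a b c d :=
  (Psi a b c d - (Lam c a * (b == d)%:R + Lam c b * (a == d)%:R)).

Hypothesis eta_inv : forall a b d e,
  \sum_h curv a b d h * eta h e + \sum_h curv a b e h * eta d h = 0.

Let Q a b d e := \sum_h Psi a b d h * eta h e.

(** Since [eta] is skew, the two sums in [eta_inv] are the lowered curvature and minus its swap in
    [d], [e]; hence the lowered curvature is symmetric in these. Separating [Psi] from [Lam] gives
    the formula. *)
Lemma lowered_skew_part a b d e :
  Q a b d e - Q a b e d =
  Lam d a * eta b e + Lam d b * eta a e - Lam e a * eta b d - Lam e b * eta a d.
Proof.
have lowE u v : \sum_h curv a b u h * eta h v =
    Q a b u v - (Lam u a * eta b v + Lam u b * eta a v).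
  under eq_bigr do rewrite mulrBl mulrDl.
  rewrite sumrB big_split /=; congr (_ - (_ + _)).
    rewrite (bigD1 b)//= eqxx mulr1 big1 ?addr0// => h hb.
    by rewrite eq_sym (negPf hb) mulr0 mul0r.
  rewrite (bigD1 a)//= eqxx mulr1 big1 ?addr0// => h hb.
  by rewrite eq_sym (negPf hb) mulr0 mul0r.
have := eta_inv a b d e; under [X in _ + X]eq_bigr do rewrite eta_skew mulrN.
rewrite sumrN !lowE => /eqP; rewrite subr_eq0 => /eqP/(canRL (subrK _)) ->.
by ring.
Qed.

Hypothesis m_gt0 : (0 < m)%N.

Let zeta := invmx eta.

Let zeta_eta d e : \sum_a zeta d a * eta a e = (d == e)%:R.
Proof. by have /matrixP/(_ d e) := mulVmx eta_unit; rewrite !mxE. Qed.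

Let eta_zeta d e : \sum_a eta d a * zeta a e = (d == e)%:R.
Proof. by have /matrixP/(_ d e) := mulmxV eta_unit; rewrite !mxE. Qed.

Let zeta_skew a b : zeta a b = - zeta b a.
Proof.
have etaT : eta^T = - eta by apply/matrixP => u v; rewrite !mxE eta_skew.
have : zeta^T = - zeta.
  rewrite /zeta trmx_inv etaT -scaleN1r.
  by rewrite invmxZ ?unitmxZ ?unitrN1 // invrN1 scaleN1r.
by move=> /matrixP/(_ b a); rewrite !mxE.
Qed.

(* Contracting [lowered_skew_part] with [zeta] kills both [Psi] terms, since
   [Psi] is symmetric and trace-free. *)
Lemma Lam_proportional : exists t, forall e b, Lam e b = t * eta e b.
Proof.
pose t := \sum_d \sum_a zeta d a * Lam d a.
have contr b e : \sum_d \sum_a zeta d a * (Q a b d e - Q a b e d) = 0.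
  transitivity (\sum_d \sum_a zeta d a * Q a b d e -
                \sum_d \sum_a zeta d a * Q a b e d).
    rewrite -sumrB; apply: eq_bigr => d _.
    by rewrite -sumrB; apply: eq_bigr => a _; rewrite mulrBr.
  (* [Q a b d e] is symmetric in [a] and [d], so its sum against the skew [zeta] vanishes. In the
     other sum [zeta] cancels the [eta] inside [Q], which leaves a trace of [Psi]. *)
  rewrite sum_skew_sym//; last first.
    move=> d a; apply: eq_bigr => h _.
    by rewrite Psi_sym12 Psi_sym23 Psi_sym12.
  rewrite sub0r; apply/eqP; rewrite oppr_eq0; apply/eqP.
  rewrite exchange_big -[RHS](Psi_trace b e) /=; apply: eq_bigr => a _.
  transitivity (\sum_h \sum_d Psi a b e h * (eta h d * zeta d a)).
    rewrite exchange_big; apply: eq_bigr => d _ /=.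
    by rewrite mulr_sumr; apply: eq_bigr => h _; ring.
  under eq_bigr do rewrite -mulr_sumr eta_zeta.
  rewrite (bigD1 a)//= eqxx mulr1 big1 ?addr0; last first.
    by move=> h /negPf ->; rewrite mulr0.
  by rewrite Psi_sym12 Psi_sym23.
(* The contraction reads [t * eta b e + Lam e b - Lam e b - m * Lam e b = 0], the factor [m] being
   the trace of the identity. Swapping [b] and [e] in [eta] produces the minus sign. *)
exists (- (t / m%:R)) => e b.
have m_neq0 : m%:R != 0 :> F by rewrite pnatr_eq0 -lt0n.
apply: (mulfI m_neq0); rewrite mulrA mulrN mulrCA divff// mulr1 mulNr.
have := contr b e.
under eq_bigr do under eq_bigr do rewrite lowered_skew_part.
have -> : \sum_d \sum_a zeta d a * (Lam d a * eta b e + Lam d b * eta a e -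
      Lam e a * eta b d - Lam e b * eta a d) =
    t * eta b e + \sum_d Lam d b * (\sum_a zeta d a * eta a e) -
    \sum_a Lam e a * (\sum_d eta b d * zeta d a) -
    Lam e b * \sum_a (\sum_d eta a d * zeta d a).
  rewrite mulr_suml !mulr_sumr [X in _ + _ - X - _](_ : _ =
    \sum_d \sum_a zeta d a * (Lam e a * eta b d)); last first.
    under eq_bigr do rewrite mulr_sumr.
    rewrite exchange_big; apply: eq_bigr => d _.
    by apply: eq_bigr => a _; ring.
  under [X in _ - X]eq_bigr do rewrite mulr_sumr.
  rewrite [X in _ - X]exchange_big -big_split -!sumrB; apply: eq_bigr => d _ /=.
  rewrite mulr_suml mulr_sumr -big_split -!sumrB; apply: eq_bigr => a _ /=.
  by ring.
under [X in _ + X - _ - _]eq_bigr do rewrite zeta_eta.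
under [X in _ - X - _]eq_bigr do rewrite eta_zeta.
under [X in _ - _ * X]eq_bigr do rewrite eta_zeta eqxx.
rewrite sumr_const card_ord (bigD1 e)//= eqxx mulr1 big1 ?addr0; last first.
  by move=> d /negPf ->; rewrite mulr0.
rewrite [X in _ - X - _](bigD1 b)//= eqxx mulr1 [X in _ - (_ + X) - _]big1.
  rewrite addr0 addrK => /eqP; rewrite subr_eq0 => /eqP tE.
  by rewrite mulrC -tE eta_skew; ring.
by move=> a; rewrite eq_sym => /negPf ->; rewrite mulr0.
Qed.

(** With [Lam] a multiple of [eta], the four [Lam] terms of [lowered_skew_part] cancel in pairs, so
    [Q a b] is symmetric in its last two indices. One order is an entry of the left side; the other
    is an entry of the right side, by skewness of [eta]. *)
Lemma Psi_skew_adjoint a b :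
  (\matrix_(d, e) Psi a b d e) *m eta =
  - (eta *m (\matrix_(d, e) Psi a b d e)^T).
Proof.
have [t LamE] := Lam_proportional.
apply/matrixP => d e; rewrite !mxE.
transitivity (Q a b d e); first by apply: eq_bigr => h _; rewrite mxE.
have -> : \sum_h eta d h * (\matrix_(d, e) Psi a b d e)^T h e = - Q a b e d.
  by rewrite -sumrN; apply: eq_bigr => h _; rewrite !mxE eta_skew; ring.
rewrite opprK; apply/eqP; rewrite -subr_eq0 lowered_skew_part !LamE.
rewrite (eta_skew b e) (eta_skew a e) (eta_skew a d) (eta_skew b d).
by apply/eqP; ring.
Qed.

End LoweredCurvature.

(** * Leibniz-type sums over product index sets *)

Lemma sum_delta (K : pzRingType) (J : finType) (j : J) (f : J -> K) :
  \sum_l (j == l)%:R * f l = f j.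
Proof.
rewrite (bigD1 j)//= eqxx mul1r big1 ?addr0// => l.
by rewrite eq_sym => /negPf ->; rewrite mul0r.
Qed.

(** An entry of the product of two matrices of the form [A (x) 1 + 1 (x) A'], where [a], [a'] are
    rows and [b], [b'] columns. It computes the quadratic term of the curvature of a tensor product;
    the last bracket holds the cross terms. *)
Lemma sum_leibniz_prod (K : comPzRingType) (J J' : finType) (p q : J * J')
    (a b : J -> K) (a' b' : J' -> K) :
  \sum_(l : J * J')
    (a l.1 * (p.2 == l.2)%:R + (p.1 == l.1)%:R * a' l.2) *
    (b l.1 * (l.2 == q.2)%:R + (l.1 == q.1)%:R * b' l.2) =
  (\sum_l a l * b l) * (p.2 == q.2)%:R +
  (\sum_l a' l * b' l) * (p.1 == q.1)%:R +
  (a q.1 * b' p.2 + b p.1 * a' q.2).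
Proof.
pose B l l' := b l * (l' == q.2)%:R + (l == q.1)%:R * b' l'.
rewrite -(pair_bigA _ (fun l l' =>
  (a l * (p.2 == l')%:R + (p.1 == l)%:R * a' l') * B l l')) /=.
transitivity (\sum_l (\sum_l' (p.2 == l')%:R * (a l * B l l') +
    \sum_l' (p.1 == l)%:R * (a' l' * B l l'))).
  apply: eq_bigr => l _; rewrite -big_split; apply: eq_bigr => l' _ /=.
  by ring.
rewrite big_split /=.
under eq_bigr do rewrite sum_delta.
under [X in _ + X]eq_bigr do rewrite -mulr_sumr.
rewrite sum_delta addrACA; congr (_ + _).
  rewrite mulr_suml -(sum_delta q.1 (fun l => a l * b' p.2)) -big_split /=.
  by apply: eq_bigr => l _; rewrite /B (eq_sym l); ring.
rewrite mulr_suml -(sum_delta q.2 (fun l => b p.1 * a' l)) -big_split /=.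
by apply: eq_bigr => l _; rewrite /B (eq_sym l); ring.
Qed.

(** A derivation applied to a decomposable tensor, as needed for the metric [eta (x) eta']. *)
Lemma sum_leibniz_tens (K : comPzRingType) (J J' : finType) (j : J) (j' : J')
    (a b : J -> K) (a' b' : J' -> K) :
  \sum_(l : J * J')
    (a l.1 * (l.2 == j')%:R + a' l.2 * (l.1 == j)%:R) * (b l.1 * b' l.2) =
  (\sum_l a l * b l) * b' j' + (\sum_l a' l * b' l) * b j.
Proof.
rewrite -(pair_bigA _ (fun l l' =>
  (a l * (l' == j')%:R + a' l' * (l == j)%:R) * (b l * b' l'))) /=.
transitivity (\sum_l (\sum_l' (j' == l')%:R * (a l * (b l * b' l')) +
    \sum_l' (j == l)%:R * (a' l' * (b l * b' l')))).
  apply: eq_bigr => l _; rewrite -big_split; apply: eq_bigr => l' _ /=.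
  by rewrite (eq_sym j) (eq_sym j'); ring.
rewrite big_split /=; under eq_bigr do rewrite sum_delta.
under [X in _ + X]eq_bigr do rewrite -mulr_sumr.
rewrite sum_delta !mulr_suml; congr (_ + _); apply: eq_bigr => l _.
  exact: mulrA.
by rewrite mulrCA mulrC.
Qed.

(** * Differentiation in one chart and contracted curvature of connections *)

Section LocalCurvature.
Local Open Scope classical_set_scope.
Variables (R : realType) (n : nat) (X : manifold R (4 * n)).
Variables (G : ag_structure X) (i : idx X) (x : X).
Hypothesis hx : dom i x.
Local Notation C := (cplx R).
Local Notation TI := ('I_(2 * n) * 'I_2)%type.
Implicit Types (f h : X -> C) (a b : TI).

(** Derivability along every vector at the single point [x] suffices for the sum and product rules.
    Unlike holomorphy, it is easily obtained for first derivatives of parallel sections, see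
    [drv_dframe_parallel]. *)
Definition drv f : Prop :=
  forall v, derivable ((f : X -> C^o) \o chart_inv i) (chart i x) v.

Lemma holomorphic_drv f : holomorphic_on (dom i) f -> drv f.
Proof. by move=> hf v; apply/diff_derivable/hf. Qed.

(** Component functions are arbitrary outside [dom i]; as the image of the chart is open,
    derivatives at [x] do not see those values. *)
Lemma near_chart (P : X -> Prop) :
  (forall y, dom i y -> P y) -> \forall z \near chart i x, P (chart_inv i z).
Proof.
move=> hP.
have : nbhs (chart i x) (chart i @` dom i).
  by apply: open_nbhs_nbhs; split; [exact: chart_open | exists x].
by apply: filterS => _ [y hy <-]; rewrite chartK//; exact: hP.
Qed.

Lemma drv_near f h : (forall y, dom i y -> f y = h y) -> drv f -> drv h.
Proof.
move=> fh df v; apply: near_eq_derivable (df v).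
exact: (near_chart (P := fun y => f y = h y)).
Qed.

Lemma dframe_near a f h : (forall y, dom i y -> f y = h y) ->
  dframe G i a f x = dframe G i a h x.
Proof.
move=> fh; apply: near_eq_derive.
exact: (near_chart (P := fun y => f y = h y)).
Qed.

Lemma drv_cst (c : C) : drv (fun=> c).
Proof. by move=> v; exact: derivable_cst. Qed.

Lemma drvD f h : drv f -> drv h -> drv (fun y => f y + h y).
Proof. by move=> df dh v; exact: derivableD (df v) (dh v). Qed.

Lemma drvN f : drv f -> drv (fun y => - f y).
Proof. by move=> df v; exact: derivableN (df v). Qed.

Lemma drvM f h : drv f -> drv h -> drv (fun y => f y * h y).
Proof. by move=> df dh v; exact: derivableM (df v) (dh v). Qed.

Lemma drv_sum (J : finType) (F : J -> X -> C) :
  (forall j, drv (F j)) -> drv (fun y => \sum_j F j y).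
Proof.
move=> dF; elim: (index_enum J) => [|j r IH].
  by under eq_fun do rewrite big_nil; exact: drv_cst.
by under eq_fun do rewrite big_cons; exact: (drvD (dF j) IH).
Qed.

Lemma dframe_cst a (c : C) y : dframe G i a (fun=> c) y = 0.
Proof. exact: derive_cst. Qed.

Lemma dframeD a f h : drv f -> drv h ->
  dframe G i a (fun y => f y + h y) x = dframe G i a f x + dframe G i a h x.
Proof. by move=> df dh; exact: deriveD (df _) (dh _). Qed.

Lemma dframeN a f : drv f ->
  dframe G i a (fun y => - f y) x = - dframe G i a f x.
Proof. by move=> df; exact: deriveN (df _). Qed.

Lemma dframeM a f h : drv f -> drv h ->
  dframe G i a (fun y => f y * h y) x =
  dframe G i a f x * h x + f x * dframe G i a h x.
Proof.
move=> df dh; apply: etrans (deriveM (df _) (dh _)) _.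
rewrite addrC /dframe /GRing.scale /= (chartK hx).
by congr (_ + _); exact: mulrC.
Qed.

Lemma dframe_sum (J : finType) a (F : J -> X -> C) : (forall j, drv (F j)) ->
  dframe G i a (fun y => \sum_j F j y) x = \sum_j dframe G i a (F j) x.
Proof.
move=> dF.
suff [] : dframe G i a (fun y => \sum_j F j y) x = \sum_j dframe G i a (F j) x
  /\ drv (fun y => \sum_j F j y) by [].
elim: (index_enum J) => [|j r [IH dr]].
  under eq_fun do rewrite big_nil.
  by rewrite big_nil dframe_cst; split=> //; exact: drv_cst.
under eq_fun do rewrite big_cons.
split; last exact: (drvD (dF j) dr).
by apply: etrans (dframeD a (dF j) dr) _; rewrite [RHS]big_cons IH.
Qed.

(** The factor is 0 or 1, so [f] need not be derivable and [y] may be any point. *)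
Lemma dframe_bool a f (p : bool) y :
  dframe G i a (fun z => f z * p%:R) y = dframe G i a f y * p%:R.
Proof.
by case: p => /=; [under eq_fun do rewrite mulr1; rewrite mulr1
  | under eq_fun do rewrite mulr0; rewrite mulr0 dframe_cst].
Qed.

Section Contraction.
Implicit Types (F : TI -> TI -> C) (A B : 'I_(2 * n)).

(* The contraction taking nabla_a nabla_b to nabla_((A|A') nabla_(|B))^(A'). *)
Definition ctr F A B : C :=
  sym2 (fun A B => \sum_(A' < 2) \sum_(B' < 2)
    eps R A' B' * F (A, A') (B, B')) A B.

Lemma ctrE F A B : ctr F A B =
  2^-1 * ((F (A, ord0) (B, ord_max) - F (A, ord_max) (B, ord0)) +
          (F (B, ord0) (A, ord_max) - F (B, ord_max) (A, ord0))).
Proof.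
have e (F' : 'I_2 -> 'I_2 -> C) :
    \sum_(A' < 2) \sum_(B' < 2) eps R A' B' * F' A' B' =
    F' ord0 ord_max - F' ord_max ord0.
  have -> : ord_max = lift ord0 (ord0 : 'I_1) by exact/val_inj.
  rewrite !big_ord_recl !big_ord0 /eps /=.
  by ring.
by rewrite /ctr /sym2 (e (fun A' B' : 'I_2 => F (A, A') (B, B')))
  (e (fun A' B' : 'I_2 => F (B, A') (A, B'))).
Qed.

Lemma ctrD F F' A B :
  ctr (fun a b => F a b + F' a b) A B = ctr F A B + ctr F' A B.
Proof. by rewrite !ctrE; ring. Qed.

Lemma ctrN F A B : ctr (fun a b => - F a b) A B = - ctr F A B.
Proof. by rewrite !ctrE; ring. Qed.

Lemma ctrMr F c A B : ctr (fun a b => F a b * c) A B = ctr F A B * c.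
Proof. by rewrite !ctrE; ring. Qed.

Lemma ctr_sum (J : finType) (F : J -> TI -> TI -> C) A B :
  ctr (fun a b => \sum_j F j a b) A B = \sum_j ctr (F j) A B.
Proof.
rewrite ctrE; under [RHS]eq_bigr do rewrite ctrE.
by rewrite -!sumrB -big_split mulr_sumr.
Qed.

(** [eps] is skew in the primed indices and the unprimed ones are symmetrised, so [ctr] sees only
    the skew part of [F]. This discards all the cross terms below. *)
Lemma ctr_sym F A B : (forall a b, F a b = F b a) -> ctr F A B = 0.
Proof.
move=> sym; rewrite ctrE (sym (A, ord_max)) (sym (B, ord_max)).
by ring.
Qed.

End Contraction.

Section Curvature.
Variable D : coeffs X TI.

(* The components of nabla_a nabla_b on the local frame; only its skew part in
   a, b is a curvature. *)
Definition curv (F : finType) (Gam : coeffs X F) a b (p q : F) : C :=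
  dframe G i a (fun y => Gam i y b p q) x +
  \sum_l Gam i x a p l * Gam i x b l q - \sum_c D i x a c b * Gam i x c p q.

(** The second covariant derivative of a function. Its contraction is carried along as an unknown
    until the curvature equations show that it vanishes. *)
Definition hess f a b : C :=
  dframe G i a (dframe G i b f) x - \sum_c D i x a c b * dframe G i c f x.

Definition drv_coeffs (F : finType) (Gam : coeffs X F) : Prop :=
  forall a p q, drv (fun y => Gam i y a p q).

Lemma drv_dual (F : finType) (Gam : coeffs X F) :
  drv_coeffs Gam -> drv_coeffs (dual_conn Gam).
Proof. by move=> dG a p q; exact: drvN. Qed.

Lemma drv_tens (F F' : finType) (Gam : coeffs X F) (Gam' : coeffs X F') :
  drv_coeffs Gam -> drv_coeffs Gam' -> drv_coeffs (tens_conn Gam Gam').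
Proof.
by move=> dG dG' a p q; apply: drvD; apply: drvM => //; exact: drv_cst.
Qed.

(** Dualising negates and transposes the coefficients, so the quadratic term keeps its sign but has
    its factors reversed. The discrepancy [M a b + M b a] is symmetric and is killed by [ctr]. *)
Lemma ctr_curv_dual (F : finType) (Gam : coeffs X F) A B p q :
  drv_coeffs Gam ->
  ctr (fun a b => curv (dual_conn Gam) a b p q) A B =
  - ctr (fun a b => curv Gam a b q p) A B.
Proof.
move=> dG.
pose M a b := \sum_l Gam i x a q l * Gam i x b l p.
have -> : (fun a b => curv (dual_conn Gam) a b p q) =
    (fun a b => - curv Gam a b q p + (M a b + M b a)).
  apply/funext => a; apply/funext => b; rewrite /curv /dual_conn dframeN//.
  under [X in _ - X = _]eq_bigr do rewrite mulrN.
  rewrite sumrN [X in _ + X - _ = _](_ : _ = M b a); last first.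
    by apply: eq_bigr => l _; rewrite mulrNN mulrC.
  by rewrite -/(M a b); ring.
rewrite ctrD ctrN [X in _ + X]ctr_sym ?addr0// => a b.
exact: addrC.
Qed.

(** The products of a [Gam] with a [Gam'] again form a symmetric expression, so after contraction
    the curvature acts as a derivation on the two factors. *)
Lemma ctr_curv_tens (F F' : finType) (Gam : coeffs X F) (Gam' : coeffs X F')
    A B p q :
  drv_coeffs Gam -> drv_coeffs Gam' ->
  ctr (fun a b => curv (tens_conn Gam Gam') a b p q) A B =
  ctr (fun a b => curv Gam a b p.1 q.1) A B * (p.2 == q.2)%:R +
  ctr (fun a b => curv Gam' a b p.2 q.2) A B * (p.1 == q.1)%:R.
Proof.
move=> dG dG'.
pose M a b := Gam i x a p.1 q.1 * Gam' i x b p.2 q.2.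
have -> : (fun a b => curv (tens_conn Gam Gam') a b p q) = (fun a b =>
    curv Gam a b p.1 q.1 * (p.2 == q.2)%:R +
    curv Gam' a b p.2 q.2 * (p.1 == q.1)%:R + (M a b + M b a)).
  apply/funext => a; apply/funext => b; rewrite /curv /tens_conn.
  have dE : dframe G i a (fun y => Gam i y b p.1 q.1 * (p.2 == q.2)%:R +
        (p.1 == q.1)%:R * Gam' i y b p.2 q.2) x =
      dframe G i a (fun y => Gam i y b p.1 q.1) x * (p.2 == q.2)%:R +
      dframe G i a (fun y => Gam' i y b p.2 q.2) x * (p.1 == q.1)%:R.
    rewrite (dframeD a (drvM (dG b p.1 q.1) (@drv_cst _))
      (drvM (@drv_cst _) (dG' b p.2 q.2))) dframe_bool; congr (_ + _).
    by under [X in dframe _ _ _ X]eq_fun do rewrite mulrC; exact: dframe_bool.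
  have prod : \sum_l (Gam i x a p.1 l.1 * (p.2 == l.2)%:R +
        (p.1 == l.1)%:R * Gam' i x a p.2 l.2) *
      (Gam i x b l.1 q.1 * (l.2 == q.2)%:R +
        (l.1 == q.1)%:R * Gam' i x b l.2 q.2) =
      (\sum_l Gam i x a p.1 l * Gam i x b l q.1) * (p.2 == q.2)%:R +
      (\sum_l Gam' i x a p.2 l * Gam' i x b l q.2) * (p.1 == q.1)%:R +
      (M a b + M b a).
    exact: (sum_leibniz_prod p q (fun l => Gam i x a p.1 l)
      (fun l => Gam i x b l q.1) (fun l => Gam' i x a p.2 l)
      (fun l => Gam' i x b l q.2)).
  rewrite [X in X + _ - _]dE prod.
  under [X in _ - X = _]eq_bigr do
    rewrite mulrDr mulrA [X in _ + _ * X]mulrC mulrA.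
  rewrite big_split /= -!mulr_suml.
  have alg (d d' s s' t t' e e' m : C) :
    d * e + d' * e' + (s * e + s' * e' + m) - (t * e + t' * e') =
    (d + s - t) * e + (d' + s' - t') * e' + m by ring.
  exact: alg.
rewrite ctrD [X in _ + X]ctr_sym ?addr0; first by rewrite ctrD !ctrMr.
by move=> a b; exact: addrC.
Qed.

Lemma parallel_dframe (F : finType) (Gam : coeffs X F) (s : components X F) :
  (forall y b q, dom i y -> nabla G Gam i (s i) y (b, q) = 0) ->
  forall y b q, dom i y ->
    - \sum_l Gam i y b q l * s i y l = dframe G i b (fun y => s i y q) y.
Proof.
by move=> par y b q hy; apply/esym/eqP; rewrite -addr_eq0; apply/eqP/par.
Qed.

(** The parallel equation expresses the first derivatives of [s] through the coefficients and [s]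
    itself, which are derivable. *)
Lemma drv_dframe_parallel (F : finType) (Gam : coeffs X F)
    (s : components X F) b p :
  drv_coeffs Gam -> (forall q, drv (fun y => s i y q)) ->
  (forall y b q, dom i y -> nabla G Gam i (s i) y (b, q) = 0) ->
  drv (dframe G i b (fun y => s i y p)).
Proof.
move=> dG ds par; apply: (drv_near (fun y => @parallel_dframe _ _ _ par y b p)).
exact: (drvN (drv_sum (fun l => drvM (dG b p l) (ds l)))).
Qed.

(** Differentiate [e_b s = - Gam_b s] once more and substitute the same equation for the new first
    derivatives. Up to a term symmetric in [a], [b] the result is minus the curvature applied to
    [s]. *)
Lemma hess_curv_parallel (F : finType) (Gam : coeffs X F)
    (s : components X F) A B p :
  drv_coeffs Gam -> (forall q, drv (fun y => s i y q)) ->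
  (forall y b q, dom i y -> nabla G Gam i (s i) y (b, q) = 0) ->
  ctr (hess (fun y => s i y p)) A B =
  - \sum_q ctr (fun a b => curv Gam a b p q) A B * s i x q.
Proof.
move=> dG ds par.
have ds1 := parallel_dframe par.
pose M a b := \sum_q (\sum_l Gam i x a p l * Gam i x b l q) * s i x q.
have -> : hess (fun y => s i y p) =
    (fun a b => - (\sum_q curv Gam a b p q * s i x q) + (M a b + M b a)).
  apply/funext => a; apply/funext => b; rewrite /hess.
  rewrite -(dframe_near a (fun y => @ds1 y b p)).
  have dprod l : dframe G i a (fun y => Gam i y b p l * s i y l) x =
      dframe G i a (fun y => Gam i y b p l) x * s i x l -
      Gam i x b p l * \sum_q Gam i x a l q * s i x q.
    by rewrite (dframeM a (dG b p l) (ds l)) -ds1// mulrN.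
  rewrite (dframeN a (drv_sum (fun l => drvM (dG b p l) (ds l)))).
  rewrite (dframe_sum a (fun l => drvM (dG b p l) (ds l))).
  under eq_bigr do rewrite dprod.
  under [X in _ - X = _]eq_bigr do rewrite -ds1// mulrN mulr_sumr.
  rewrite !sumrN sumrB.
  have -> : \sum_l Gam i x b p l * (\sum_q Gam i x a l q * s i x q) = M b a.
    under eq_bigr do rewrite mulr_sumr.
    rewrite exchange_big; apply: eq_bigr => q _; rewrite mulr_suml.
    by apply: eq_bigr => l _; rewrite mulrA.
  have -> : \sum_q curv Gam a b p q * s i x q =
      \sum_q dframe G i a (fun y => Gam i y b p q) x * s i x q + M a b -
      \sum_c \sum_q D i x a c b * (Gam i x c p q * s i x q).
    rewrite [X in _ - X]exchange_big -big_split -sumrB.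
    apply: eq_bigr => q _; rewrite /curv mulrBl mulrDl; congr (_ - _).
    by rewrite mulr_suml; apply: eq_bigr => c _; rewrite mulrA.
  have alg (d m m' t : C) : - (d - m') + t = - (d + m - t) + (m + m') by ring.
  by rewrite opprK; exact: alg.
rewrite ctrD ctrN ctr_sum [X in _ + X]ctr_sym ?addr0; last first.
  by move=> a b; exact: addrC.
by congr (- _); apply: eq_bigr => q _; rewrite ctrMr.
Qed.

End Curvature.

Section Box.
Variables (Gam : coeffs X 'I_(2 * n)) (Gam' : coeffs X 'I_2).
Variables (F : finType) (GamE : coeffs X F).
Hypothesis dE : drv_coeffs GamE.
Local Notation D := (tens_conn Gam Gam').

Lemma nabla_scaled_frame h e y b p :
  nabla G GamE i (fun y p => h y * (p == e)%:R) y (b, p) =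
  dframe G i b h y * (p == e)%:R + GamE i y b p e * h y.
Proof.
rewrite /nabla /= dframe_bool; congr (_ + _).
rewrite -(sum_delta e (fun l => GamE i y b p l * h y)).
by apply: eq_bigr => l _; rewrite (eq_sym e) mulrA mulrC.
Qed.

Lemma nabla2_scaled_frame h e a b p :
  drv h -> (forall c, drv (dframe G i c h)) ->
  nabla2 G Gam Gam' GamE i (fun y p => h y * (p == e)%:R) x (a, (b, p)) =
  hess D h a b * (p == e)%:R + curv D GamE a b p e * h x +
  (dframe G i a h x * GamE i x b p e + dframe G i b h x * GamE i x a p e).
Proof.
move=> dh ddh; rewrite /nabla2 [LHS]/nabla.
set N := nabla G GamE i _.
have NE y c q :
    N y (c, q) = dframe G i c h y * (q == e)%:R + GamE i y c q e * h y.
  exact: nabla_scaled_frame.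
rewrite [X in X + _](_ : _ = dframe G i a (dframe G i b h) x * (p == e)%:R +
    (dframe G i a (fun y => GamE i y b p e) x * h x +
     GamE i x b p e * dframe G i a h x)); last first.
  have NfE : (fun y => dframe G i b h y * (p == e)%:R + GamE i y b p e * h y) =
      N^~ (b, p) by apply/funext => y; rewrite NE.
  rewrite -[LHS]/(dframe G i a (N^~ (b, p)) x) -NfE.
  rewrite (dframeD a (drvM (ddh b) (@drv_cst _)) (drvM (@dE b p e) dh)).
  by rewrite dframe_bool (dframeM a (@dE b p e) dh).
rewrite [X in _ + X](_ : _ =
    - (\sum_c D i x a c b * dframe G i c h x) * (p == e)%:R -
    (\sum_c D i x a c b * GamE i x c p e) * h x +
    GamE i x a p e * dframe G i b h x +
    (\sum_l GamE i x a p l * GamE i x b l e) * h x); last first.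
  (* The connection on [T*X (x) E] splits: [- D] acts on the index [b], [GamE] on the index [p]. *)
  rewrite (eq_bigr (fun cl => (- D i x a cl.1 b * (p == cl.2)%:R +
    (b == cl.1)%:R * GamE i x a p cl.2) * N x (cl.1, cl.2))); last by case.
  rewrite -(pair_bigA _ (fun c l => (- D i x a c b * (p == l)%:R +
    (b == c)%:R * GamE i x a p l) * N x (c, l))) /=.
  transitivity (\sum_c (\sum_l (p == l)%:R * (- D i x a c b * N x (c, l)) +
      \sum_l (b == c)%:R * (GamE i x a p l * N x (c, l)))).
    apply: eq_bigr => c _; rewrite -big_split; apply: eq_bigr => l _ /=.
    by rewrite mulrDl -!mulrA; congr (_ + _); exact: mulrCA.
  rewrite big_split /=; under eq_bigr do rewrite sum_delta NE.
  under [X in _ + X = _]eq_bigr do rewrite -mulr_sumr.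
  rewrite sum_delta -addrA; congr (_ + _).
    rewrite -sumrN !mulr_suml -sumrB; apply: eq_bigr => c _.
    by rewrite !mulNr mulrDr opprD !mulrA.
  rewrite -(sum_delta e (fun l => GamE i x a p l * dframe G i b h x)).
  rewrite mulr_suml -big_split; apply: eq_bigr => l _ /=.
  rewrite NE (eq_sym e) mulrDr mulrA.
  by congr (_ + _); [exact: mulrC | exact: mulrA].
rewrite /hess /curv.
have alg (d u v w t r m m' k : C) :
  d * k + (u * w + m) + (- t * k - r * w + m' + v * w) =
  (d - t) * k + (u + v - r) * w + (m + m') by ring.
by rewrite alg; congr (_ + (_ + _)); exact: mulrC.
Qed.

(** The mixed first-derivative terms are symmetric and drop out. Comparison with [box_frame], the
    case of the constant function 1, isolates the contracted Hessian of [h]. *)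
Lemma box_scaled_frame h e A B p :
  drv h -> (forall c, drv (dframe G i c h)) ->
  box G Gam Gam' GamE i (fun y p => h y * (p == e)%:R) x A B p =
  ctr (hess D h) A B * (p == e)%:R +
  ctr (fun a b => curv D GamE a b p e) A B * h x.
Proof.
move=> dh ddh; rewrite -[LHS]/(ctr (fun a b => nabla2 G Gam Gam' GamE i
  (fun y p => h y * (p == e)%:R) x (a, (b, p))) A B).
under eq_fun do under eq_fun do rewrite nabla2_scaled_frame//.
rewrite ctrD [X in _ + X]ctr_sym ?addr0; first by rewrite ctrD !ctrMr.
by move=> a b; exact: addrC.
Qed.

Lemma hess_cst c : hess D (fun=> c) = (fun _ _ => 0).
Proof.
apply/funext => a; apply/funext => b; rewrite /hess.
have -> : dframe G i b (fun=> c) = (fun=> 0).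
  by apply/funext => y; exact: dframe_cst.
rewrite dframe_cst big1 ?subr0// => d _.
by rewrite dframe_cst mulr0.
Qed.

Lemma box_frame e A B p :
  box G Gam Gam' GamE i (fun _ p => (p == e)%:R) x A B p =
  ctr (fun a b => curv D GamE a b p e) A B.
Proof.
have -> : (fun _ p => (p == e)%:R) =
    (fun (_ : X) p => 1 * (p == e)%:R) :> (X -> F -> C).
  by apply/funext => y; apply/funext => q; rewrite mul1r.
rewrite (@box_scaled_frame (fun=> 1)).
- by rewrite hess_cst ctrE !subrr addr0 mulr0 mul0r add0r mulr1.
- exact: drv_cst.
- move=> c; have -> : dframe G i c (fun=> 1) = (fun=> 0).
    by apply/funext => y; exact: dframe_cst.
  exact: drv_cst.
Qed.

End Box.
End LocalCurvature.

(** * Skew forms and the curvature of a parallel metric *)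

Lemma nondegenerate_unitmx (R : realType) m (b : 'I_m * 'I_m -> cplx R) :
  Defs.nondegenerate b -> \matrix_(u, v) b (u, v) \in unitmx.
Proof.
move=> nd; rewrite -row_free_unit; apply/inj_row_free => v vb0.
apply/rowP => u; rewrite mxE; apply: (nd (v 0)) => w.
move/rowP/(_ w) : vb0; rewrite !mxE; apply: etrans.
by apply: eq_bigr => l _; rewrite mxE.
Qed.

Lemma nondegenerate_skew2 (R : realType) (b : 'I_2 * 'I_2 -> cplx R) :
  Defs.nondegenerate b -> (forall u v, b (u, v) = - b (v, u)) ->
  b (ord0, lift ord0 ord0) != 0.
Proof.
move=> nd skew; apply/negP => /eqP b01.
have diag0 u : b (u, u) = 0.
  by apply/eqP; rewrite -eqNr -skew.
suff: (1 : cplx R) = 0 by move/eqP; rewrite oner_eq0.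
apply: (nd (fun=> 1) _ ord0) => w.
rewrite !big_ord_recl big_ord0 !mul1r addr0.
case: (unliftP ord0 w) => [j ->|->]; rewrite ?(ord1 j) ?b01 ?diag0 ?addr0//.
by rewrite add0r skew b01 oppr0.
Qed.

Section CompatibleMetric.
Variables (R : realType) (n : nat) (X : manifold R (4 * n)).
Variables (G : ag_structure X) (i : idx X) (x : X).
Hypothesis hx : dom i x.
Local Notation C := (cplx R).
Local Notation I := 'I_(2 * n).
Local Notation TI := (I * 'I_2)%type.
Variables (Gam : coeffs X I) (Gam' : coeffs X 'I_2).
Local Notation D := (tens_conn Gam Gam').
Local Notation K A B p q := (ctr (fun a b => curv G i x D Gam a b p q) A B).
Local Notation K' A B p q := (ctr (fun a b => curv G i x D Gam' a b p q) A B).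

(** The contracted curvature of [T*X (x) T*X] annihilates the parallel [g], and it acts on [eta] and
    [eta'] as a derivation. On a skew form in rank two it acts through its trace, which is zero on
    [S']; only the action on [eta] remains, times a nonzero component of [eta']. *)
Lemma parallel_metric_curv (g : components X (TI * TI)%type)
    (eta : components X (I * I)%type)
    (eta' : components X ('I_2 * 'I_2)%type) A B :
  drv_coeffs i x Gam -> drv_coeffs i x Gam' ->
  (forall q, drv i x (fun y => g i y q)) ->
  (forall y b q, dom i y ->
    nabla G (tens_conn (dual_conn D) (dual_conn D)) i (g i) y (b, q) = 0) ->
  (forall q, ctr (hess G i x D (fun y => g i y q)) A B = 0) ->
  (forall a b, g i x (a, b) = eta i x (a.1, b.1) * eta' i x (a.2, b.2)) ->
  (forall u v, eta i x (u, v) = - eta i x (v, u)) ->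
  (forall u v, eta' i x (u, v) = - eta' i x (v, u)) ->
  Defs.nondegenerate (eta' i x) ->
  \sum_w K' A B w w = 0 ->
  forall d e, \sum_u K A B u d * eta i x (u, e) +
              \sum_u K A B u e * eta i x (d, u) = 0.
Proof.
move=> dG dG' dg par hess0 gE skew skew' nd' tr0 d e.
have dD := drv_tens dG dG'.
pose o0 : 'I_2 := ord0; pose o1 : 'I_2 := lift ord0 ord0.
have e01 : eta' i x (o0, o1) != 0 by exact: nondegenerate_skew2.
pose KD a b :=
  K A B a.1 b.1 * (a.2 == b.2)%:R + K' A B a.2 b.2 * (a.1 == b.1)%:R.
have KDE p q :
    ctr (fun a b => curv G i x D (dual_conn D) a b p q) A B = - KD q p.
  by rewrite (ctr_curv_dual G D A B p q dD) (ctr_curv_tens G D A B q p dG dG').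
(* The primed indices 0 and 1 pick out the one independent component of [eta']. *)
pose dd : TI := (d, o0); pose ee : TI := (e, o1).
have := hess_curv_parallel hx D A B (dd, ee)
  (drv_tens (drv_dual dD) (drv_dual dD)) dg par.
rewrite hess0 => /esym/eqP; rewrite oppr_eq0.
have -> : \sum_q ctr (fun a b => curv G i x D
      (tens_conn (dual_conn D) (dual_conn D)) a b (dd, ee) q) A B * g i x q =
    - (\sum_u KD u dd * g i x (u, ee) + \sum_u KD u ee * g i x (dd, u)).
  rewrite (eq_bigr (fun q => - ((KD q.1 dd * (ee == q.2)%:R +
    KD q.2 ee * (dd == q.1)%:R) * g i x (q.1, q.2)))); last first.
    move=> [u v] _.
    rewrite (ctr_curv_tens G D A B _ _ (drv_dual dD) (drv_dual dD)).
    by rewrite !KDE /= !mulNr -opprD mulNr.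
  rewrite sumrN -(pair_bigA _ (fun u v => (KD u dd * (ee == v)%:R +
    KD v ee * (dd == u)%:R) * g i x (u, v))) /=; congr (- _).
  transitivity (\sum_u (\sum_v (ee == v)%:R * (KD u dd * g i x (u, v)) +
      \sum_v (dd == u)%:R * (KD v ee * g i x (u, v)))).
    apply: eq_bigr => u _; rewrite -big_split; apply: eq_bigr => v _ /=.
    by rewrite mulrDl mulrAC mulrC; congr (_ + _); rewrite mulrAC mulrC.
  rewrite big_split /=; under eq_bigr do rewrite sum_delta.
  under [X in _ + X = _]eq_bigr do rewrite -mulr_sumr.
  by rewrite sum_delta.
under eq_bigr do rewrite gE.
under [X in _ + X]eq_bigr do rewrite gE.
rewrite (sum_leibniz_tens d o0 (fun u => K A B u d) (fun u => eta i x (u, e))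
  (fun w => K' A B w o0) (fun w => eta' i x (w, o1))).
rewrite (sum_leibniz_tens e o1 (fun u => K A B u e) (fun u => eta i x (d, u))
  (fun w => K' A B w o1) (fun w => eta' i x (o0, w))).
(* The diagonal of [eta'] vanishes, so the two primed sums reduce to [K' o0 o0] and [K' o1 o1] times
   the same component; by [tr0] these are opposite. *)
have diag0 u : eta' i x (u, u) = 0 by apply/eqP; rewrite -eqNr -skew'.
have -> : \sum_w K' A B w o0 * eta' i x (w, o1) =
    K' A B o0 o0 * eta' i x (o0, o1).
  by rewrite !big_ord_recl big_ord0 diag0 mulr0 !addr0.
have -> : \sum_w K' A B w o1 * eta' i x (o0, w) =
    K' A B o1 o1 * eta' i x (o0, o1).
  by rewrite !big_ord_recl big_ord0 diag0 mulr0 add0r addr0.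
move: tr0; rewrite !big_ord_recl big_ord0 addr0 => /eqP.
rewrite addr_eq0 -/o0 -/o1 => /eqP ->.
set P := \sum_u _; set Q := \sum_u _; set k := K' A B o1 o1.
rewrite oppr_eq0 => /eqP PQ; apply: (mulIf e01); rewrite mul0r -[RHS]PQ.
by ring.
Qed.

End CompatibleMetric.

(** * The trace identity at a point of a chart *)

Theorem proposition6p1 (R : realType) (n : nat) (hn : (1 <= n)%N)
    (X : manifold R (4 * n)) (hX : contractible R X)
    (G : ag_structure X) (hG : tfg G)
    (Psi : components X ('I_(2 * n) * 'I_(2 * n) * 'I_(2 * n) * 'I_(2 * n) * unit)%type)
    (hPsi : invariant_curvature G Psi)
    (hg : exists g, compatible_metric G g)
    (k : nat) (hk : (1 <= k)%N)
    (i : idx X) (x : X) (hx : dom i x)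
    (A B : 'I_k -> 'I_(2 * n)) :
  \sum_(c : {ffun 'I_k -> 'I_(2 * n)})
     \prod_(l < k) Psi i x (A l, B l, c l, c (ordS l), tt)
  + (-1) ^+ k.+1 *
    \sum_(c : {ffun 'I_k -> 'I_(2 * n)})
       \prod_(l < k)
         Psi i x (A (rev_ord l), B (rev_ord l), c l, c (ordS l), tt)
  = 0.
Proof.
have [g [[[g_hol _] _ _] [eta [eta' [[_ skew nd] [_ skew' nd'] gE]]]
  [Gam [Gam' [weyl [_ _ par]]]]]] := hg.
have [[Gam_hol _] [Gam'_hol _] _ _ _] := weyl.
have [_ Psi_sym Psi_tr /(_ _ _ _ openT weyl)[Phi [Lam [_ Phi_sym _]]]] := hPsi.
move=> /(_ i (dom i)); rewrite setTI.
move=> /(_ _ _ (dom_open i) (@subset_refl _ _)) curvE.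
have dG : drv_coeffs i x Gam.
  move=> a p q; apply: holomorphic_drv => //.
  by have := Gam_hol i a p q; rewrite setTI.
have dG' : drv_coeffs i x Gam'.
  move=> a p q; apply: holomorphic_drv => //.
  by have := Gam'_hol i a p q; rewrite setTI.
have g_holi q : holomorphic_on (dom i) (fun y => g i y q).
  by have := g_hol i q; rewrite setTI.
have par_i y b q : dom i y ->
    nabla G (tens_conn (dual_conn (tens_conn Gam Gam'))
      (dual_conn (tens_conn Gam Gam'))) i (g i) y (b, q) = 0.
  exact: par.
have dg q : drv i x (fun y => g i y q) by exact: holomorphic_drv.
have dD := drv_tens dG dG'; have dDD := drv_tens (drv_dual dD) (drv_dual dD).
have hol_bool h (p : bool) :
    holomorphic_on (dom i) h -> holomorphic_on (dom i) (fun y => h y * p%:R).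
  case: p; first by under eq_fun do rewrite mulr1.
  under [in X in _ -> X]eq_fun do rewrite mulr0.
  by move=> _ j y _ _; exact: differentiable_cst.
have hol_cst (c : cplx R) : holomorphic_on (dom i) (fun=> c).
  by move=> j y _ _; exact: differentiable_cst.
(* Frame sections of [S] and [S'] (with the other section zero) turn the curvature equations into
   formulas for the curvature components. *)
have frameE a b p q :
    ctr (fun u v => curv G i x (tens_conn Gam Gam') Gam u v p q) a b =
    Psi i x (a, b, q, p, tt) - (Lam i x (q, a, tt) * (b == p)%:R +
                                Lam i x (q, b, tt) * (a == p)%:R).
  have [+ _ _ _] := curvE (fun _ p => (p == q)%:R) (fun _ _ => 0)
    (fun p => hol_cst _) (fun p => hol_cst _) x hx.
  move=> /(_ a b p); rewrite (box_frame G hx Gam Gam' dG) => ->.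
  rewrite -(sum_delta q (fun q => Psi i x (a, b, q, p, tt) -
    (Lam i x (q, a, tt) * (b == p)%:R + Lam i x (q, b, tt) * (a == p)%:R))).
  apply: eq_bigr => e _.
  by rewrite (eq_sym q) [RHS]mulrC /sym2 mulrA divff ?mul1r.
have frameE' a b p q :
    ctr (fun u v => curv G i x (tens_conn Gam Gam') Gam' u v p q) a b =
    \sum_c' eps R p c' * Phi i x (a, b, q, c').
  have [_ + _ _] := curvE (fun _ _ => 0) (fun _ p => (p == q)%:R)
    (fun p => hol_cst _) (fun p => hol_cst _) x hx.
  move=> /(_ a b p); rewrite (box_frame G hx Gam Gam' dG') => ->.
  rewrite -(sum_delta q (fun q => \sum_c' eps R p c' * Phi i x (a, b, q, c'))).
  by apply: eq_bigr => e _; rewrite (eq_sym q) [RHS]mulrC.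
(* Take [nu] to be the function [g_q] times the first frame section. Its box is the contracted
   Hessian of [g_q] times that section plus [g_q] times the box of the section; the curvature
   equation depends only on the value of [nu] at [x] and yields the second summand alone. *)
have hess0 a b q :
    ctr (hess G i x (tens_conn Gam Gam') (fun y => g i y q)) a b = 0.
  have [_ + _ _] := curvE (fun _ _ => 0)
    (fun y (p : 'I_2) => g i y q * (p == ord0)%:R)
    (fun p => hol_cst _) (fun p => hol_bool _ _ (g_holi q)) x hx.
  move=> /(_ a b ord0); rewrite (box_scaled_frame hx Gam Gam' dG') //.
    rewrite frameE' eqxx mulr1 !big_ord_recl !big_ord0 /=.
    rewrite mulr1 mulr0 mulr0 !addr0.
    by move=> /(canRL (addrK _)); rewrite subrr.
  by move=> c; exact: (drv_dframe_parallel hx dDD dg par_i).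
(* The trace contracts the skew [eps] with [Phi], which is symmetric in its primed indices. *)
have trace0 a b :
    \sum_w ctr (fun u v =>
      curv G i x (tens_conn Gam Gam') Gam' u v w w) a b = 0.
  rewrite !big_ord_recl big_ord0 !frameE' !big_ord_recl !big_ord0 /eps /=.
  have [_ ->] := Phi_sym i x a b ord0 (lift ord0 ord0) I hx.
  by ring.
have metric_curv a b := parallel_metric_curv hx dG dG' dg par_i (hess0 a b)
  (fun u v => gE i x u v hx) (fun u v => skew i x u v hx)
  (fun u v => skew' i x u v hx) (nd' i x hx) (trace0 a b).
pose H : 'M[cplx R]_(2 * n) := \matrix_(u, v) eta i x (u, v).
pose P l : 'M[cplx R]_(2 * n) := \matrix_(u, v) Psi i x (A l, B l, u, v, tt).
have H_unit : H \in unitmx by apply: nondegenerate_unitmx; exact: nd.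
have adj l : P l *m H = - (H *m (P l)^T).
  apply: (@Psi_skew_adjoint _ _ H (fun a b c d => Psi i x (a, b, c, d, tt))
    (fun a b => Lam i x (a, b, tt))) => //.
  - by move=> a b; rewrite !mxE skew.
  - by move=> a b c d; have [] := Psi_sym i x a b c d hx.
  - by move=> a b c d; have [] := Psi_sym i x a b c d hx.
  - by move=> a b; exact: Psi_tr.
  - move=> a b d e; rewrite -[RHS](metric_curv a b d e).
    by congr (_ + _); apply: eq_bigr => u _; rewrite frameE !mxE.
  - by rewrite muln_gt0.
have PE (f g0 : 'I_k -> 'I_k) : \sum_(c : {ffun 'I_k -> 'I_(2 * n)})
     \prod_(l < k) Psi i x (A (f l), B (f l), c l, c (g0 l), tt) =
   \sum_(c : {ffun 'I_k -> 'I_(2 * n)}) \prod_(l < k) P (f l) (c l) (c (g0 l)).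
  by apply: eq_bigr => c _; apply: eq_bigr => l _; rewrite mxE.
rewrite (PE id) (PE (@rev_ord k)) (cyclic_sum_skew_adjoint H_unit adj).
by rewrite exprS mulN1r mulNr subrr.
Qed.
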